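(* Every projective right $S^3_q$-module can be equipped with a right $q$-affine connection.
   Context: Let $q>0$ be real, $q\neq 1$. $S^3_q$ is the unital complex $*$-algebra generated by $a,a^*,c,c^*$ with relations $ac=qca$, $c^*a^*=qa^*c^*$, $ac^*=qc^*a$, $ca^*=qa^*c$, $cc^*=c^*c$, $a^*a+c^*c=aa^*+q^2cc^*=\mathbf 1$. $\mathcal U_q(\mathrm{su}(2))$ is the algebra generated by $E,F,K,K^{-1}$ with $K^{\pm1}E=q^{\pm1}EK^{\pm1}$, $K^{\pm1}F=q^{\mp1}FK^{\pm1}$, $[E,F]=\frac{K^2-K^{-2}}{q-q^{-1}}$, and coproduct $\Delta(E)=E\otimes K+K^{-1}\otimes E$, $\Delta(F)=F\otimes K+K^{-1}\otimes F$, $\Delta(K^{\pm1})=K^{\pm1}\otimes K^{\pm1}$ (counit $\epsilon(K)=1$, $\epsilon(E)=\epsilon(F)=0$). It acts on $S^3_q$ from the left; the action is written $h(f)$ (or $h\triangleright f$), makes $S^3_q$ a left module algebra, $h(fg)=h_{(1)}(f)\,h_{(2)}(g)$ and $h(\mathbf 1)=\epsilon(h)\mathbf 1$, and is determined by $K^{\pm1}(a)=q^{\mp1/2}a$, $K^{\pm1}(c)=q^{\mp1/2}c$, $K^{\pm1}(a^* )=q^{\pm1/2}a^*$, $K^{\pm1}(c^* )=q^{\pm1/2}c^*$; $E(a)=-qc^*$, $E(c)=a^*$, $E(a^* )=E(c^* )=0$; $F(a)=F(c)=0$, $F(a^* )=c$, $F(c^* )=-q^{-1}a$. Set $X_+=\sqrt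 q\,EK$, $X_-=\frac1{\sqrt q}FK$, $X_z=\frac{1-K^4}{1-q^{-2}}$, and $\sigma_+=\sigma_-=K^2$, $\sigma_z=K^4$, all acting on $S^3_q$ by the left action; then $X_a(fg)=fX_a(g)+X_a(f)\sigma_a(g)$ for $a\in\{+,-,z\}$. The quantum tangent space $TS^3_q$ is the complex vector space spanned by $X_+,X_-,X_z$. A right $q$-affine connection on a right $S^3_q$-module $M$ is a map $\nabla:TS^3_q\times M\to M$, $(X,m)\mapsto\nabla_Xm$, that is $\mathbb C$-linear in each argument and satisfies $\nabla_{X_a}(mf)=(\nabla_{X_a}m)\sigma_a(f)+mX_a(f)$ for $a\in\{+,-,z\}$, $m\in M$, $f\in S^3_q$. *)

(* Defs.v *)
From HB Require Import structures.
From mathcomp Require Import all_boot all_order all_algebra.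
From mathcomp Require Import boolp reals complex ring.

Set Implicit Arguments.
Unset Strict Implicit.
Unset Printing Implicit Defensive.

Import Order.TTheory GRing.Theory Num.Theory.
Local Open Scope ring_scope.
Local Open Scope quotient_scope.
Local Open Scope complex_scope.

(* Noncommutative polynomial expressions over [gen]; the algebra presented by
   [rel] is their quotient by the least congruence that contains [rel] and
   satisfies the axioms of unital associative [K]-algebras. *)
Inductive expr (K gen : Type) : Type :=
| Gen of gen
| Scal of K
| Add of expr K gen & expr K gen
| Mul of expr K gen & expr K gen.
Arguments Gen {K gen} _.
Arguments Scal {K gen} _%_R.
Arguments Add {K gen} _ _.
Arguments Mul {K gen} _ _.

Declare Scope expr_scope.
Delimit Scope expr_scope with X.
Bind Scope expr_scope with expr.
Notation "c %:S" := (Scal c%R) (at level 2, left associativity, format "c %:S")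
  : expr_scope.
Notation "s + t" := (Add s t) : expr_scope.
Notation "s * t" := (Mul s t) : expr_scope.
Notation "- t" := (Mul (Scal (-1)%R) t) : expr_scope.
Notation "s - t" := (Add s (Mul (Scal (-1)%R) t)) : expr_scope.

HB.instance Definition _ K gen := gen_eqMixin (expr K gen).
HB.instance Definition _ K gen := gen_choiceMixin (expr K gen).

Section Presentation.
Variables (K : comNzRingType) (gen : Type).
Variable rel : expr K gen -> expr K gen -> Prop.
Implicit Types (s t u : expr K gen) (a b : K).

Inductive cong : expr K gen -> expr K gen -> Prop :=
| cong_rel s t : rel s t -> cong s t
| cong_refl s : cong s s
| cong_sym s t : cong s t -> cong t s
| cong_trans s t u : cong s t -> cong t u -> cong s u
| cong_add s s' t t' : cong s s' -> cong t t' -> cong (s + t)%X (s' + t')%X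
| cong_mul s s' t t' : cong s s' -> cong t t' -> cong (s * t)%X (s' * t')%X
| cong_addA s t u : cong (s + (t + u))%X (s + t + u)%X
| cong_addC s t : cong (s + t)%X (t + s)%X
| cong_add0 s : cong (0%:S + s)%X s
| cong_addN s : cong (- s + s)%X 0%:S%X
| cong_mulA s t u : cong (s * (t * u))%X (s * t * u)%X
| cong_mul1 s : cong (1%:S * s)%X s
| cong_mulDl s t u : cong ((s + t) * u)%X (s * u + t * u)%X
| cong_mulDr s t u : cong (s * (t + u))%X (s * t + s * u)%X
| cong_scalD a b : cong (a + b)%:S%X (a%:S + b%:S)%X
| cong_scalM a b : cong (a * b)%:S%X (a%:S * b%:S)%X
| cong_scalC a s : cong (a%:S * s)%X (s * a%:S)%X.

Definition congb s t := `[< cong s t >].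

Lemma congb_refl : reflexive congb.
Proof. by move=> s; apply/asboolP; apply: cong_refl. Qed.

Lemma congb_sym : symmetric congb.
Proof. by move=> s t; apply: asbool_equiv_eq; split=> /cong_sym. Qed.

Lemma congb_trans : transitive congb.
Proof.
by move=> t s u /asboolP st /asboolP tu; apply/asboolP/(cong_trans st tu).
Qed.

Canonical congb_equiv := EquivRel congb congb_refl congb_sym congb_trans.
Canonical congb_encModRel := defaultEncModRel congb.

Definition presented := {eq_quot congb}.
HB.instance Definition _ := Choice.on presented.

Definition cls s : presented := \pi_presented s.

Lemma cls_eqP s t : reflect (cong s t) (cls s == cls t).
Proof. by rewrite /cls piE; apply: asboolP. Qed.

Lemma cls_eq s t : cong s t -> cls s = cls t.
Proof. by move=> st; apply/eqP/cls_eqP. Qed.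

Lemma clsK (x : presented) : cls (repr x) = x.
Proof. exact: reprK. Qed.

Lemma cls_surj (x : presented) : exists s, x = cls s.
Proof. by exists (repr x); rewrite clsK. Qed.

Lemma cong_repr s : cong (repr (cls s)) s.
Proof. by apply/cls_eqP; rewrite clsK. Qed.

Definition padd (x y : presented) := cls (repr x + repr y)%X.
Definition pmul (x y : presented) := cls (repr x * repr y)%X.
Definition pscale a (x : presented) := cls (a%:S * repr x)%X.

Lemma paddE s t : padd (cls s) (cls t) = cls (s + t)%X.
Proof. by apply: cls_eq; apply: cong_add; apply: cong_repr. Qed.

Lemma pmulE s t : pmul (cls s) (cls t) = cls (s * t)%X.
Proof. by apply: cls_eq; apply: cong_mul; apply: cong_repr. Qed.

Lemma pscaleE a s : pscale a (cls s) = cls (a%:S * s)%X.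
Proof.
by apply: cls_eq; apply: cong_mul; [apply: cong_refl | apply: cong_repr].
Qed.

Lemma paddA : associative padd.
Proof.
move=> x y z; have [s ->] := cls_surj x; have [t ->] := cls_surj y.
have [u ->] := cls_surj z; rewrite !paddE; exact/cls_eq/cong_addA.
Qed.

Lemma paddC : commutative padd.
Proof.
move=> x y; have [s ->] := cls_surj x; have [t ->] := cls_surj y.
rewrite !paddE; exact/cls_eq/cong_addC.
Qed.

Lemma padd0 : left_id (cls 0%:S) padd.
Proof.
move=> x; have [s ->] := cls_surj x; rewrite paddE; exact/cls_eq/cong_add0.
Qed.

Lemma paddN : left_inverse (cls 0%:S) (pscale (-1)) padd.
Proof.
move=> x; have [s ->] := cls_surj x.
rewrite pscaleE paddE; exact/cls_eq/cong_addN.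
Qed.

HB.instance Definition _ :=
  GRing.isZmodule.Build presented paddA paddC padd0 paddN.

Lemma pmulA : associative pmul.
Proof.
move=> x y z; have [s ->] := cls_surj x; have [t ->] := cls_surj y.
have [u ->] := cls_surj z; rewrite !pmulE; exact/cls_eq/cong_mulA.
Qed.

Lemma pmul1 : left_id (cls 1%:S) pmul.
Proof.
move=> x; have [s ->] := cls_surj x; rewrite pmulE; exact/cls_eq/cong_mul1.
Qed.

Lemma pmulr1 : right_id (cls 1%:S) pmul.
Proof.
move=> x; have [s ->] := cls_surj x; rewrite pmulE.
apply/cls_eq/(cong_trans _ (cong_mul1 s))/cong_sym/cong_scalC.
Qed.

Lemma pmulDl : left_distributive pmul +%R.
Proof.
move=> x y z; have [s ->] := cls_surj x; have [t ->] := cls_surj y.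
have [u ->] := cls_surj z; rewrite /GRing.add /= !(paddE, pmulE).
exact/cls_eq/cong_mulDl.
Qed.

Lemma pmulDr : right_distributive pmul +%R.
Proof.
move=> x y z; have [s ->] := cls_surj x; have [t ->] := cls_surj y.
have [u ->] := cls_surj z; rewrite /GRing.add /= !(paddE, pmulE).
exact/cls_eq/cong_mulDr.
Qed.

HB.instance Definition _ :=
  GRing.Zmodule_isPzRing.Build presented pmulA pmul1 pmulr1 pmulDl pmulDr.

Lemma clsD s t : cls (s + t)%X = cls s + cls t.
Proof. by rewrite /GRing.add /= paddE. Qed.

Lemma clsM s t : cls (s * t)%X = cls s * cls t.
Proof. by rewrite /GRing.mul /= pmulE. Qed.

Lemma pscale_mul a x : pscale a x = cls a%:S * x.
Proof. by have [s ->] := cls_surj x; rewrite pscaleE clsM. Qed.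

Lemma pscaleA a b x : pscale a (pscale b x) = pscale (a * b) x.
Proof.
by rewrite !pscale_mul mulrA -clsM; congr (_ * _); apply/cls_eq/cong_sym/cong_scalM.
Qed.

Lemma pscale1 : left_id 1 pscale.
Proof. by move=> x; rewrite pscale_mul [LHS]mul1r. Qed.

Lemma pscaleDr : right_distributive pscale +%R.
Proof. by move=> a x y; rewrite !pscale_mul mulrDr. Qed.

Lemma pscaleDl x : {morph pscale^~ x : a b / a + b}.
Proof.
by move=> a b; rewrite !pscale_mul -mulrDl -clsD (cls_eq (cong_scalD _ _)).
Qed.

HB.instance Definition _ := GRing.Zmodule_isLmodule.Build K presented
  pscaleA pscale1 pscaleDr pscaleDl.

Lemma clsZ a s : cls (a%:S * s)%X = a *: cls s.
Proof. by rewrite /GRing.scale /= pscaleE. Qed.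

Lemma cls1 : cls 1%:S%X = 1. Proof. by []. Qed.

Lemma clsS a : cls a%:S%X = a *: (1 : presented).
Proof. by rewrite -clsZ clsM cls1 mulr1. Qed.

Lemma presented_scaleAl a (x y : presented) : a *: (x * y) = (a *: x) * y.
Proof. by rewrite /GRing.scale /= !pscale_mul mulrA. Qed.

Lemma presented_scaleAr a (x y : presented) : a *: (x * y) = x * (a *: y).
Proof.
rewrite /GRing.scale /= !pscale_mul !mulrA; congr (_ * _).
have [s ->] := cls_surj x; rewrite -!clsM; exact/cls_eq/cong_scalC.
Qed.

Section Eval.
Variables (A : algType K) (v : gen -> A).

Fixpoint teval t : A :=
  match t with
  | Gen g => v g
  | Scal a => a%:A
  | Add s t => teval s + teval t
  | Mul s t => teval s * teval t
  end.

Hypothesis vrel : forall s t, rel s t -> teval s = teval t.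

Lemma teval_cong s t : cong s t -> teval s = teval t.
Proof.
elim=> //= {s t}; rewrite ?scale0r ?scale1r ?scaleN1r.
- by move=> s t u _ -> _ ->.
- by move=> s s' t t' _ -> _ ->.
- by move=> s s' t t' _ -> _ ->.
- by move=> *; rewrite addrA.
- by move=> *; rewrite addrC.
- by move=> *; rewrite add0r.
- by move=> *; rewrite mulN1r addNr.
- by move=> *; rewrite mulrA.
- by move=> *; rewrite mul1r.
- by move=> *; rewrite mulrDl.
- by move=> *; rewrite mulrDr.
- by move=> *; rewrite scalerDl.
- by move=> *; rewrite -scalerAl mul1r scalerA.
- by move=> *; rewrite -scalerAl -scalerAr mul1r mulr1.
Qed.

Definition peval (x : presented) : A := teval (repr x).

Lemma pevalE s : peval (cls s) = teval s.
Proof. exact/teval_cong/cong_repr. Qed.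

Lemma pevalG g : peval (cls (Gen g)) = v g. Proof. exact: pevalE. Qed.
Lemma peval1 : peval 1 = 1. Proof. by rewrite -cls1 pevalE /= scale1r. Qed.

Lemma pevalD x y : peval (x + y) = peval x + peval y.
Proof.
have [s ->] := cls_surj x; have [t ->] := cls_surj y.
by rewrite -clsD !pevalE.
Qed.

Lemma pevalM x y : peval (x * y) = peval x * peval y.
Proof.
have [s ->] := cls_surj x; have [t ->] := cls_surj y.
by rewrite -clsM !pevalE.
Qed.

Lemma pevalZ a x : peval (a *: x) = a *: peval x.
Proof.
by have [s ->] := cls_surj x; rewrite -clsZ !pevalE /= -scalerAl mul1r.
Qed.

Lemma presented_oner_neq0 : (1 : presented) != 0.
Proof.
apply/eqP => /(congr1 peval); rewrite peval1 -(addrN (1 : presented)).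
rewrite -scaleN1r pevalD pevalZ scaleN1r addrN => /eqP.
by rewrite oner_eq0.
Qed.
End Eval.

End Presentation.

Variant s3q_gen := ga | gas | gc | gcs.

Section S3q.
Variables (R : realType) (q : R).
Local Notation C := (R[i]).
Local Notation qq := (q%:C%:S)%X.
Local Notation a := (Gen ga).
Local Notation a' := (Gen gas).
Local Notation c := (Gen gc).
Local Notation c' := (Gen gcs).

Inductive s3q_rel : expr C s3q_gen -> expr C s3q_gen -> Prop :=
| s3q_ac : s3q_rel (a * c)%X (qq * c * a)%X
| s3q_csas : s3q_rel (c' * a')%X (qq * a' * c')%X
| s3q_acs : s3q_rel (a * c')%X (qq * c' * a)%X
| s3q_cas : s3q_rel (c * a')%X (qq * a' * c)%X
| s3q_ccs : s3q_rel (c * c')%X (c' * c)%X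
| s3q_sphere1 : s3q_rel (a' * a + c' * c)%X 1%:S%X
| s3q_sphere2 : s3q_rel (a * a' + (q ^+ 2)%:C%:S * c * c')%X 1%:S%X.

Definition S3q := presented s3q_rel.

HB.instance Definition _ := GRing.PzRing.on S3q.
HB.instance Definition _ := GRing.Lmodule.on S3q.

Fact S3q_oner_neq0 : (1 : S3q) != 0.
Proof.
pose v g : C^o := match g with ga | gas => 1 | gc | gcs => 0 end.
apply: (@presented_oner_neq0 _ _ s3q_rel C^o v) => s t.
case=> /=; rewrite ?(mulr0, mul0r, mulr1, mul1r, addr0, scale1r) //.
Qed.

HB.instance Definition _ := GRing.PzSemiRing_isNonZero.Build S3q S3q_oner_neq0.
HB.instance Definition _ :=
  GRing.Lmodule_isLalgebra.Build C S3q (@presented_scaleAl _ _ _).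
HB.instance Definition _ :=
  GRing.Lalgebra_isAlgebra.Build C S3q (@presented_scaleAr _ _ _).

Definition s3q_cls : expr C s3q_gen -> S3q := @cls _ _ s3q_rel.
Definition s3q_a : S3q := s3q_cls a.
Definition s3q_as : S3q := s3q_cls a'.
Definition s3q_c : S3q := s3q_cls c.
Definition s3q_cs : S3q := s3q_cls c'.

Lemma s3q_cls_rel s t : s3q_rel s t -> s3q_cls s = s3q_cls t.
Proof. by move=> st; apply/cls_eq/cong_rel. Qed.
Lemma s3q_clsD s t : s3q_cls (s + t)%X = s3q_cls s + s3q_cls t.
Proof. exact: clsD. Qed.
Lemma s3q_clsM s t : s3q_cls (s * t)%X = s3q_cls s * s3q_cls t.
Proof. exact: clsM. Qed.
Lemma s3q_clsS z : s3q_cls z%:S%X = z%:A.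
Proof. exact: clsS. Qed.
Lemma s3q_clsZ z s : s3q_cls (z%:S * s)%X = z *: s3q_cls s.
Proof. exact: clsZ. Qed.
Lemma s3q_cls_repr x : s3q_cls (repr x) = x.
Proof. exact: clsK. Qed.
Lemma s3q_cls_surj x : exists s, x = s3q_cls s.
Proof. by exists (repr x); rewrite s3q_cls_repr. Qed.

(* The relations are stable under the antilinear antiautomorphism that exchanges
   [a], [a'] and [c], [c'], so presenting [S^3_q] as an algebra on these four
   generators is the same as presenting it as a *-algebra on [a] and [c]. *)
Fixpoint s3q_star_expr (t : expr C s3q_gen) : S3q :=
  match t with
  | Gen ga => s3q_as
  | Gen gas => s3q_a
  | Gen gc => s3q_cs
  | Gen gcs => s3q_c
  | Scal z => (z^*)%R%:A
  | Add s t => s3q_star_expr s + s3q_star_expr t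
  | Mul s t => s3q_star_expr t * s3q_star_expr s
  end.

Definition s3q_star (x : S3q) : S3q := s3q_star_expr (repr x).

Lemma s3q_relE :
  [/\ s3q_a * s3q_c = q%:C *: (s3q_c * s3q_a),
      s3q_cs * s3q_as = q%:C *: (s3q_as * s3q_cs),
      s3q_a * s3q_cs = q%:C *: (s3q_cs * s3q_a) &
      s3q_c * s3q_as = q%:C *: (s3q_as * s3q_c)] /\
  [/\ s3q_c * s3q_cs = s3q_cs * s3q_c,
      s3q_as * s3q_a + s3q_cs * s3q_c = 1 &
      s3q_a * s3q_as + (q ^+ 2)%:C *: (s3q_c * s3q_cs) = 1].
Proof.
have := (s3q_cls_rel s3q_ac, s3q_cls_rel s3q_csas, s3q_cls_rel s3q_acs, s3q_cls_rel s3q_cas).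
have := (s3q_cls_rel s3q_ccs, s3q_cls_rel s3q_sphere1, s3q_cls_rel s3q_sphere2).
rewrite !(s3q_clsD, s3q_clsM, s3q_clsS) -?mulrA -?scalerAl !mul1r !scale1r.
by case=> [[-> ->] ->] [[[-> ->] ->] ->].
Qed.

Lemma s3q_star_cong s t :
  cong s3q_rel s t -> s3q_star_expr s = s3q_star_expr t.
Proof.
have [[ac csas acs cas] [ccs sph1 sph2]] := s3q_relE.
have cj (x : R) : ((x%:C)^*)%R = x%:C by rewrite conj_Creal // complex_real.
elim=> //= {s t}.
- move=> s t [] /=; rewrite ?cj -?scalerAl -?scalerAr ?(mul1r, mulr1) //.
  + by rewrite rmorph1 scale1r.
  + by rewrite rmorph1 scale1r.
- by move=> s t u _ -> _ ->.
- by move=> s s' t t' _ -> _ ->.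
- by move=> s s' t t' _ -> _ ->.
- by move=> *; rewrite addrA.
- by move=> *; rewrite addrC.
- by move=> *; rewrite rmorph0 scale0r add0r.
- by move=> s; rewrite rmorphN1 rmorph0 scaleN1r mulrN1 addNr scale0r.
- by move=> *; rewrite mulrA.
- by move=> *; rewrite rmorph1 scale1r mulr1.
- by move=> *; rewrite mulrDr.
- by move=> *; rewrite mulrDl.
- by move=> *; rewrite rmorphD scalerDl.
- by move=> *; rewrite rmorphM -scalerAr mulr1 scalerA.
- by move=> *; rewrite -scalerAl -scalerAr mul1r mulr1.
Qed.

Lemma s3q_starE s : s3q_star (s3q_cls s) = s3q_star_expr s.
Proof. exact/s3q_star_cong/cong_repr. Qed.

Lemma s3q_starP :
  [/\ s3q_star s3q_a = s3q_as, s3q_star s3q_c = s3q_cs,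
      involutive s3q_star,
      forall x y, s3q_star (x * y) = s3q_star y * s3q_star x &
      forall z x y, s3q_star (z *: x + y) = (z^*)%R *: s3q_star x + s3q_star y].
Proof.
have starM x y : s3q_star (x * y) = s3q_star y * s3q_star x.
  have [s ->] := s3q_cls_surj x; have [t ->] := s3q_cls_surj y.
  by rewrite -s3q_clsM !s3q_starE.
have starD x y : s3q_star (x + y) = s3q_star x + s3q_star y.
  have [s ->] := s3q_cls_surj x; have [t ->] := s3q_cls_surj y.
  by rewrite -s3q_clsD !s3q_starE.
have starZ z x : s3q_star (z *: x) = (z^*)%R *: s3q_star x.
  have [s ->] := s3q_cls_surj x.
  by rewrite -s3q_clsZ !s3q_starE /= -scalerAr mulr1.
have star1 : s3q_star 1 = 1 by rewrite -[X in s3q_star X]scale1r -s3q_clsS s3q_starE /= rmorph1 scale1r.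
split=> // [||x|z x y]; [exact: s3q_starE | exact: s3q_starE | | ]; last first.
  by rewrite starD starZ.
have [s ->] := s3q_cls_surj x; rewrite s3q_starE.
elim: s => [[]|z|s IHs t IHt|s IHs t IHt] /=; try exact: s3q_starE.
- by rewrite starZ star1 conjCK s3q_clsS.
- by rewrite starD IHs IHt s3q_clsD.
- by rewrite starM IHs IHt s3q_clsM.
Qed.

Lemma s3q_ind (P : S3q -> Prop) :
  P s3q_a -> P s3q_as -> P s3q_c -> P s3q_cs ->
  (forall z, P z%:A) -> (forall x y, P x -> P y -> P (x + y)) ->
  (forall x y, P x -> P y -> P (x * y)) -> forall x, P x.
Proof.
move=> Pa Pas Pc Pcs Pz PD PM x; have [s ->] := s3q_cls_surj x.
elim: s => [[]|z|s IHs t IHt|s IHs t IHt] //.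
- by rewrite s3q_clsS.
- by rewrite s3q_clsD; apply: PD.
- by rewrite s3q_clsM; apply: PM.
Qed.

End S3q.

Variant uq_gen := gE | gF | gK | gKi.

Section Uq.
Variables (R : realType) (q : R).
Local Notation C := (R[i]).
Local Notation qq := (q%:C%:S)%X.
Local Notation qi := (q^-1%:C%:S)%X.
Local Notation E := (Gen gE).
Local Notation F := (Gen gF).
Local Notation K := (Gen gK).
Local Notation K' := (Gen gKi).

Inductive uq_rel : expr C uq_gen -> expr C uq_gen -> Prop :=
| uq_KKi : uq_rel (K * K')%X 1%:S%X
| uq_KiK : uq_rel (K' * K)%X 1%:S%X
| uq_KE : uq_rel (K * E)%X (qq * E * K)%X
| uq_KiE : uq_rel (K' * E)%X (qi * E * K')%X
| uq_KF : uq_rel (K * F)%X (qi * F * K)%X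
| uq_KiF : uq_rel (K' * F)%X (qq * F * K')%X
| uq_EF : uq_rel (E * F - F * E)%X
                 ((q - q^-1)^-1%:C%:S * (K * K - K' * K'))%X.

Definition Uq := presented uq_rel.

HB.instance Definition _ := GRing.PzRing.on Uq.
HB.instance Definition _ := GRing.Lmodule.on Uq.

Definition uq_counit_gen (g : uq_gen) : C^o :=
  match g with gE | gF => 0 | gK | gKi => 1 end.

Fact uq_counit_rel s t : uq_rel s t ->
  teval uq_counit_gen s = teval uq_counit_gen t.
Proof.
case=> /=; rewrite ?(mulr0, mul0r, mulr1, mul1r, addr0, scale1r) //.
by rewrite scaleN1r subrr mulr0.
Qed.

Fact Uq_oner_neq0 : (1 : Uq) != 0.
Proof. exact: (presented_oner_neq0 uq_counit_rel). Qed.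

HB.instance Definition _ := GRing.PzSemiRing_isNonZero.Build Uq Uq_oner_neq0.
HB.instance Definition _ :=
  GRing.Lmodule_isLalgebra.Build C Uq (@presented_scaleAl _ _ _).
HB.instance Definition _ :=
  GRing.Lalgebra_isAlgebra.Build C Uq (@presented_scaleAr _ _ _).

Definition uq_cls : expr C uq_gen -> Uq := @cls _ _ uq_rel.
Definition uqE : Uq := uq_cls E.
Definition uqF : Uq := uq_cls F.
Definition uqK : Uq := uq_cls K.
Definition uqKi : Uq := uq_cls K'.

Definition uq_counit (h : Uq) : C := @peval _ _ uq_rel C^o uq_counit_gen h.

(* The coproduct of the class of an expression, as a list of pairs
   [(h1, h2)] standing for the sum of the pure tensors [h1 (x) h2]. *)
Fixpoint uq_coprod (t : expr C uq_gen) : seq (Uq * Uq) :=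
  match t with
  | Gen gE => [:: (uqE, uqK); (uqKi, uqE)]
  | Gen gF => [:: (uqF, uqK); (uqKi, uqF)]
  | Gen gK => [:: (uqK, uqK)]
  | Gen gKi => [:: (uqKi, uqKi)]
  | Scal z => [:: (z%:A, 1)]
  | Add s t => uq_coprod s ++ uq_coprod t
  | Mul s t => [seq (x.1 * y.1, x.2 * y.2) | x <- uq_coprod s, y <- uq_coprod t]
  end.

Local Notation S := (S3q q).
Local Notation a := (s3q_a q).
Local Notation a' := (s3q_as q).
Local Notation c := (s3q_c q).
Local Notation c' := (s3q_cs q).
Local Notation rq := ((Num.sqrt q)%:C).
Local Notation rqi := ((Num.sqrt q)^-1%:C).

(* These conditions characterize a single map [act]: see [uq_action_unique]
   and [uq_action_exists]. *)
Record is_uq_action (act : Uq -> S -> S) : Prop := IsUqAction {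
  uq_act_linearl : forall f, linear (act^~ f);
  uq_act_linearr : forall h, linear (act h);
  uq_act1 : forall f, act 1 f = f;
  uq_actM : forall h k f, act (h * k) f = act h (act k f);
  uq_act_algM : forall t f g,
    act (uq_cls t) (f * g) = \sum_(p <- uq_coprod t) act p.1 f * act p.2 g;
  uq_act_alg1 : forall h, act h 1 = (uq_counit h)%:A;
  uq_actK : [/\ act uqK a = rqi *: a, act uqK c = rqi *: c,
                act uqK a' = rq *: a' & act uqK c' = rq *: c'];
  uq_actKi : [/\ act uqKi a = rq *: a, act uqKi c = rq *: c,
                 act uqKi a' = rqi *: a' & act uqKi c' = rqi *: c'];
  uq_actE : [/\ act uqE a = - q%:C *: c', act uqE c = a',
                act uqE a' = 0 & act uqE c' = 0];
  uq_actF : [/\ act uqF a = 0, act uqF c = 0,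
                act uqF a' = c & act uqF c' = - q^-1%:C *: a]
}.

Lemma uq_cls_rel s t : uq_rel s t -> uq_cls s = uq_cls t.
Proof. by move=> st; apply/cls_eq/cong_rel. Qed.
Lemma uq_clsD s t : uq_cls (s + t)%X = uq_cls s + uq_cls t.
Proof. exact: clsD. Qed.
Lemma uq_clsM s t : uq_cls (s * t)%X = uq_cls s * uq_cls t.
Proof. exact: clsM. Qed.
Lemma uq_clsS z : uq_cls z%:S%X = z%:A.
Proof. exact: clsS. Qed.
Lemma uq_clsZ z s : uq_cls (z%:S * s)%X = z *: uq_cls s.
Proof. exact: clsZ. Qed.
Lemma uq_cls_surj x : exists s, x = uq_cls s.
Proof. by exists (repr x); rewrite /uq_cls clsK. Qed.

Lemma uq_action_unique act1 act2 :
  is_uq_action act1 -> is_uq_action act2 -> forall h f, act1 h f = act2 h f.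
Proof.
move=> [l1 r1 o1 m1 am1 a1 k1 ki1 e1 f1] [l2 r2 o2 m2 am2 a2 k2 ki2 e2 f2].
have add1 h k f : act1 (h + k) f = act1 h f + act1 k f.
  by have := l1 f 1 h k; rewrite !scale1r.
have add2 h k f : act2 (h + k) f = act2 h f + act2 k f.
  by have := l2 f 1 h k; rewrite !scale1r.
have sc1 z f : act1 z%:A f = z *: f.
  have l0 : act1 0 f = 0 by have := l1 f (-1) 0 0; rewrite scaler0 addr0 scaleN1r addNr.
  by have := l1 f z 1 0; rewrite addr0 l0 addr0 o1.
have sc2 z f : act2 z%:A f = z *: f.
  have l0 : act2 0 f = 0 by have := l2 f (-1) 0 0; rewrite scaler0 addr0 scaleN1r addNr.
  by have := l2 f z 1 0; rewrite addr0 l0 addr0 o2.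
have radd1 h f g : act1 h (f + g) = act1 h f + act1 h g.
  by have := r1 h 1 f g; rewrite !scale1r.
have radd2 h f g : act2 h (f + g) = act2 h f + act2 h g.
  by have := r2 h 1 f g; rewrite !scale1r.
have rsc1 h z : act1 h z%:A = z *: act1 h 1.
  have l0 : act1 h 0 = 0 by have := r1 h (-1) 0 0; rewrite scaler0 addr0 scaleN1r addNr.
  by have := r1 h z 1 0; rewrite !addr0 l0 addr0.
have rsc2 h z : act2 h z%:A = z *: act2 h 1.
  have l0 : act2 h 0 = 0 by have := r2 h (-1) 0 0; rewrite scaler0 addr0 scaleN1r addNr.
  by have := r2 h z 1 0; rewrite !addr0 l0 addr0.
case: k1 k2 => ? ? ? ? [? ? ? ?]; case: ki1 ki2 => ? ? ? ? [? ? ? ?].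
case: e1 e2 => ? ? ? ? [? ? ? ?]; case: f1 f2 => ? ? ? ? [? ? ? ?].
have eK f : act1 uqK f = act2 uqK f.
  elim/s3q_ind: f => [||||z|x y hx hy|x y hx hy];
    [congruence | congruence | congruence | congruence
    | by rewrite rsc1 rsc2 a1 a2 | by rewrite radd1 radd2 hx hy |].
  by rewrite am1 am2 /= !big_seq1 /= hx hy.
have eKi f : act1 uqKi f = act2 uqKi f.
  elim/s3q_ind: f => [||||z|x y hx hy|x y hx hy];
    [congruence | congruence | congruence | congruence
    | by rewrite rsc1 rsc2 a1 a2 | by rewrite radd1 radd2 hx hy |].
  by rewrite am1 am2 /= !big_seq1 /= hx hy.
have eE f : act1 uqE f = act2 uqE f.
  elim/s3q_ind: f => [||||z|x y hx hy|x y hx hy];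
    [congruence | congruence | congruence | congruence
    | by rewrite rsc1 rsc2 a1 a2 | by rewrite radd1 radd2 hx hy |].
  by rewrite am1 am2 /= !big_cons !big_nil /= hx hy eK eKi.
have eF f : act1 uqF f = act2 uqF f.
  elim/s3q_ind: f => [||||z|x y hx hy|x y hx hy];
    [congruence | congruence | congruence | congruence
    | by rewrite rsc1 rsc2 a1 a2 | by rewrite radd1 radd2 hx hy |].
  by rewrite am1 am2 /= !big_cons !big_nil /= hx hy eK eKi.
move=> h; have [s ->] := uq_cls_surj h.
elim: s => [[]|z|s IHs t IHt|s IHs t IHt] f //.
- by rewrite uq_clsS sc1 sc2.
- by rewrite uq_clsD add1 add2 IHs IHt.
- by rewrite uq_clsM m1 m2 IHt IHs.
Qed.

Section Existence.
Hypotheses (q_gt0 : 0 < q) (q_neq1 : q != 1).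

Let p : C := rq.
Let p_neq0 : p != 0.
Proof. by rewrite fmorph_eq0 sqrtr_eq0 -ltNge. Qed.
Let qE : q%:C = p * p.
Proof. by rewrite /p -rmorphM -expr2 sqr_sqrtr // ltW. Qed.
Let q2E : (q ^+ 2)%:C = p * p * p * p.
Proof. by rewrite expr2 rmorphM /= qE !mulrA. Qed.
Let rqiE : rqi = p^-1.
Proof. by rewrite fmorphV. Qed.
Let qiE : q^-1%:C = p^-1 * p^-1.
Proof. by rewrite fmorphV /= qE invfM. Qed.
Let qqE : ((q - q^-1)^-1)%:C = (p * p - p^-1 * p^-1)^-1.
Proof. by rewrite fmorphV rmorphB /= qE qiE. Qed.
Let pden : p * p - p^-1 * p^-1 != 0.
Proof.
rewrite -qE -qiE -rmorphB fmorph_eq0 subr_eq0; apply/eqP => e.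
have : q * q = 1 by rewrite [X in X * _]e mulVf // gt_eqF.
move/eqP; rewrite -expr2 -[1](expr1n _ 2) eqrXn2 ?(ltW q_gt0) ?ler01 //.
by rewrite (negPf q_neq1).
Qed.

Let pden4 : p * p * (p * p) - 1 != 0.
Proof.
move: pden; apply: contraNneq => e.
have -> : p * p - p^-1 * p^-1 = (p * p * (p * p) - 1) / (p * p) by field.
by rewrite e mul0r.
Qed.

Definition kgen (r : C) (g : s3q_gen) : S :=
  match g with
  | ga => r^-1 *: a | gc => r^-1 *: c | gas => r *: a' | gcs => r *: c'
  end.

Let nf := (mulr1, mul1r, mulr0, mul0r, scaler0, addr0, add0r).

Lemma kgen_rel r : r != 0 -> forall s t, s3q_rel q s t ->
  teval (kgen r) s = teval (kgen r) t.
Proof.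
have [[ac csas acs cas] [ccs sph1 sph2]] := s3q_relE q.
move=> r0 s t [] /=; rewrite -?scalerAl -?scalerAr -?scalerAl ?nf.
- by rewrite ac !scalerA; congr (_ *: _); ring.
- by rewrite csas !scalerA; congr (_ *: _); ring.
- by rewrite acs !scalerA; congr (_ *: _); ring.
- by rewrite cas !scalerA; congr (_ *: _); ring.
- by rewrite ccs !scalerA; congr (_ *: _); ring.
- by rewrite !scalerA mulfV // !scale1r sph1.
- by rewrite !scalerA mulVf // -mulrA mulfV // mulr1 !scale1r sph2.
Qed.

Definition khom (r : C) : S -> S := @peval _ _ (s3q_rel q) S (kgen r).

Section Dev.
Variable v : s3q_gen -> S.

(* The twisted derivation
   [d (f g) = d f * khom p g + khom p^-1 f * d g] extending [v]. *)
Fixpoint dev_expr (t : expr C s3q_gen) : S :=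
  match t with
  | Gen g => v g
  | Scal _ => 0
  | Add s t => dev_expr s + dev_expr t
  | Mul s t => dev_expr s * teval (kgen p) t + teval (kgen p^-1) s * dev_expr t
  end.

Hypothesis vrel : forall s t, s3q_rel q s t -> dev_expr s = dev_expr t.

Let pV_neq0 : p^-1 != 0. Proof. by rewrite invr_eq0. Qed.

Lemma dev_cong s t : cong (s3q_rel q) s t -> dev_expr s = dev_expr t.
Proof.
have kc r : r != 0 -> forall s t, cong (s3q_rel q) s t ->
    teval (kgen r) s = teval (kgen r) t.
  by move=> r0; apply: teval_cong; apply: kgen_rel.
elim=> //= {s t}.
- by move=> s t u _ -> _ ->.
- by move=> s s' t t' _ -> _ ->.
- by move=> s s' t t' ss -> tt ->; rewrite (kc _ p_neq0 _ _ tt) (kc _ pV_neq0 _ _ ss).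
- by move=> *; rewrite addrA.
- by move=> *; rewrite addrC.
- by move=> *; rewrite add0r.
- by move=> s; rewrite mul0r add0r scaleN1r mulN1r addNr.
- by move=> s t u; rewrite !mulrDl !mulrDr !mulrA addrA.
- by move=> s; rewrite mul0r add0r scale1r mul1r.
- by move=> s t u; rewrite !mulrDl addrACA.
- by move=> s t u; rewrite !mulrDr addrACA.
- by move=> *; rewrite addr0.
- by move=> *; rewrite mul0r mulr0 addr0.
- by move=> z s; rewrite mul0r mulr0 addr0 add0r -scalerAl -scalerAr mul1r mulr1.
Qed.

Definition dev (f : S) : S := dev_expr (repr f).

Lemma devE s : dev (s3q_cls q s) = dev_expr s.
Proof. exact/dev_cong/cong_repr. Qed.

End Dev.

Lemma khomP r : r != 0 ->
  [/\ forall s, khom r (s3q_cls q s) = teval (kgen r) s, khom r 1 = 1,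
      linear (khom r) & forall x y, khom r (x * y) = khom r x * khom r y].
Proof.
move=> r0; have rl := kgen_rel r0.
split=> [s||z x y|x y]; rewrite /khom.
- exact: pevalE.
- exact: peval1.
- by rewrite pevalD // pevalZ.
- by rewrite pevalM.
Qed.

Lemma devP v : (forall s t, s3q_rel q s t -> dev_expr v s = dev_expr v t) ->
  [/\ forall g, dev v (s3q_cls q (Gen g)) = v g, dev v 1 = 0, linear (dev v) &
      forall x y, dev v (x * y) = dev v x * khom p y + khom p^-1 x * dev v y].
Proof.
have pV0 : p^-1 != 0 by rewrite invr_eq0.
have [kE _ _ _] := khomP p_neq0; have [kiE _ _ _] := khomP pV0.
move=> rl; split=> [g||z x y|x y].
- by rewrite devE.
- have -> : 1 = s3q_cls q 1%:S by rewrite s3q_clsS scale1r.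
  by rewrite devE.
- have [s ->] := s3q_cls_surj x; have [t ->] := s3q_cls_surj y.
  rewrite -s3q_clsZ -s3q_clsD !devE //= mul0r add0r -scalerAl mul1r //.
- have [s ->] := s3q_cls_surj x; have [t ->] := s3q_cls_surj y.
  by rewrite -s3q_clsM kE kiE !devE.
Qed.

Definition egen (g : s3q_gen) : S :=
  match g with
  | ga => - q%:C *: c' | gc => a' | gas => 0 | gcs => 0
  end.
Definition fgen (g : s3q_gen) : S :=
  match g with
  | ga => 0 | gc => 0 | gas => c | gcs => - q^-1%:C *: a
  end.

Lemma egen_rel s t : s3q_rel q s t -> dev_expr egen s = dev_expr egen t.
Proof.
have [[ac csas acs cas] [ccs sph1 sph2]] := s3q_relE q.
have aa : a * a' = 1 - (q ^+ 2)%:C *: (c' * c) by rewrite -sph2 ccs addrK.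
have aa' : a' * a = 1 - c' * c by rewrite -sph1 addrK.
case=> /=; rewrite ?invrK; do ?[rewrite -scalerAl | rewrite -scalerAr]; rewrite ?nf //; do ?rewrite -scalerAl.
- rewrite ccs aa aa' !scalerBr !scalerA -!scaleNr addrCA -scalerDl.
  rewrite -addrA -scalerDl qE q2E.
  by congr (_ *: _ + _ *: _); field.
- by rewrite !scalerA qE; congr (_ *: _); field.
- by rewrite !scalerA qE; congr (_ *: _); field.
- by rewrite csas !scalerA qE; congr (_ *: _); field.
- rewrite csas !scalerA -scalerDl qE.
  by rewrite [X in X *: _](_ : _ = 0) ?scale0r //; field.
- rewrite csas !scalerA -scalerDl qE q2E.
  by rewrite [X in X *: _](_ : _ = 0) ?scale0r //; field.
Qed.

Lemma fgen_rel s t : s3q_rel q s t -> dev_expr fgen s = dev_expr fgen t.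
Proof.
have [[ac csas acs cas] [ccs sph1 sph2]] := s3q_relE q.
have aa : a * a' = 1 - (q ^+ 2)%:C *: (c' * c) by rewrite -sph2 ccs addrK.
have aa' : a' * a = 1 - c' * c by rewrite -sph1 addrK.
case=> /=; rewrite ?invrK; do ?[rewrite -scalerAl | rewrite -scalerAr]; rewrite ?nf //; do ?rewrite -scalerAl.
- rewrite ccs aa aa' !scalerBr !scalerA -!scaleNr -addrA -scalerDl.
  rewrite addrCA -scalerDl qE qiE q2E.
  by congr (_ *: _ + _ *: _); field.
- by rewrite !scalerA qE qiE; congr (_ *: _); field.
- by rewrite !scalerA qE; congr (_ *: _); field.
- by rewrite ac !scalerA qE qiE; congr (_ *: _); field.
- rewrite ac !scalerA -scalerDl qE qiE.
  by rewrite [X in X *: _](_ : _ = 0) ?scale0r //; field.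
- rewrite ac !scalerA -scalerDl qE qiE q2E.
  by rewrite [X in X *: _](_ : _ = 0) ?scale0r //; field.
Qed.

Definition uact_gen (g : uq_gen) : S -> S :=
  match g with
  | gE => dev egen | gF => dev fgen | gK => khom p | gKi => khom p^-1
  end.

Fixpoint uact_expr (t : expr C uq_gen) (f : S) : S :=
  match t with
  | Gen g => uact_gen g f
  | Scal z => z *: f
  | Add s t => uact_expr s f + uact_expr t f
  | Mul s t => uact_expr s (uact_expr t f)
  end.

Let pV_neq0 : p^-1 != 0. Proof. by rewrite invr_eq0. Qed.
Let kP := khomP p_neq0.
Let kiP := khomP pV_neq0.
Let eP := devP egen_rel.
Let fP := devP fgen_rel.

Lemma uact_gen_linear g : linear (uact_gen g).
Proof. by case: g; [case: eP | case: fP | case: kP | case: kiP]. Qed.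

Lemma uact_expr_linear t : linear (uact_expr t).
Proof.
elim: t => [g|z|s IHs t IHt|s IHs t IHt] k f g' /=.
- exact: uact_gen_linear.
- by rewrite scalerDr !scalerA mulrC.
- by rewrite IHs IHt scalerDr addrACA.
- by rewrite IHt IHs.
Qed.

Lemma uact_genM g x y : uact_gen g (x * y) =
  match g with
  | gE | gF => uact_gen g x * uact_gen gK y + uact_gen gKi x * uact_gen g y
  | gK | gKi => uact_gen g x * uact_gen g y
  end.
Proof.
case: g => /=.
- by have [_ _ _ ->] := eP.
- by have [_ _ _ ->] := fP.
- by have [_ _ _ ->] := kP.
- by have [_ _ _ ->] := kiP.
Qed.

Lemma uact_gen1 g : uact_gen g 1 = match g with gE | gF => 0 | _ => 1 end.
Proof. by case: g; [case: eP | case: fP | case: kP | case: kiP]. Qed.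

Lemma uact_gen_gen g x : uact_gen g (s3q_cls q (Gen x)) =
  match g with
  | gE => egen x | gF => fgen x | gK => kgen p x | gKi => kgen p^-1 x
  end.
Proof.
case: g => /=.
- by have [-> _ _ _] := eP.
- by have [-> _ _ _] := fP.
- by have [-> _ _ _] := kP; case: x.
- by have [-> _ _ _] := kiP; case: x.
Qed.

Arguments uact_gen : simpl never.

Let uD g f h : uact_gen g (f + h) = uact_gen g f + uact_gen g h.
Proof. by have := uact_gen_linear g 1 f h; rewrite !scale1r. Qed.
Let u0 g : uact_gen g 0 = 0.
Proof. by have := uact_gen_linear g (-1) 0 0; rewrite scaler0 addr0 scaleN1r addNr. Qed.
Let uZ g z f : uact_gen g (z *: f) = z *: uact_gen g f.
Proof. by have := uact_gen_linear g z f 0; rewrite !addr0 u0 addr0. Qed.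

Let uaE x : uact_gen x a = _ := uact_gen_gen x ga.
Let uasE x : uact_gen x a' = _ := uact_gen_gen x gas.
Let ucE x : uact_gen x c = _ := uact_gen_gen x gc.
Let ucsE x : uact_gen x c' = _ := uact_gen_gen x gcs.
Let ugE := (uaE, uasE, ucE, ucsE).

Lemma uact_KKi f : uact_gen gK (uact_gen gKi f) = f.
Proof.
elim/s3q_ind: f => [||||z|x y hx hy|x y hx hy];
  rewrite ?ugE /= ?uZ ?ugE /= ?uact_gen1 /= ?scalerA ?invrK ?mulfV ?mulVf ?scale1r //.
- by rewrite !uD hx hy.
- by rewrite !uact_genM hx hy.
Qed.

Lemma uact_KiK f : uact_gen gKi (uact_gen gK f) = f.
Proof.
elim/s3q_ind: f => [||||z|x y hx hy|x y hx hy];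
  rewrite ?ugE /= ?uZ ?ugE /= ?uact_gen1 /= ?scalerA ?invrK ?mulfV ?mulVf ?scale1r //.
- by rewrite !uD hx hy.
- by rewrite !uact_genM hx hy.
Qed.

Definition is_EF (g : uq_gen) := match g with gE | gF => true | _ => false end.

Lemma uact_comm (k g : uq_gen) (w : C) : ~~ is_EF k -> is_EF g ->
  (forall x, uact_gen k (uact_gen g (s3q_cls q (Gen x))) =
             w *: uact_gen g (uact_gen k (s3q_cls q (Gen x)))) ->
  forall f, uact_gen k (uact_gen g f) = w *: uact_gen g (uact_gen k f).
Proof.
move=> hk hg hw f.
have kk x : uact_gen k (uact_gen gK x) = uact_gen gK (uact_gen k x).
  by case: k hk {hw} => // _; rewrite uact_KKi uact_KiK.
have kki x : uact_gen k (uact_gen gKi x) = uact_gen gKi (uact_gen k x).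
  by case: k hk {hw kk} => // _; rewrite uact_KKi uact_KiK.
have kM x y : uact_gen k (x * y) = uact_gen k x * uact_gen k y.
  by rewrite uact_genM; case: k hk {hw kk kki}.
have gM x y : uact_gen g (x * y) =
    uact_gen g x * uact_gen gK y + uact_gen gKi x * uact_gen g y.
  by rewrite uact_genM; case: g hg {hw}.
have g1 : uact_gen g 1 = 0 by rewrite uact_gen1; case: g hg {hw gM}.
have k1 : uact_gen k 1 = 1 by rewrite uact_gen1; case: k hk {hw kk kki kM}.
elim/s3q_ind: f => [||||z|x y hx hy|x y hx hy]; try exact: hw.
- by rewrite !uZ g1 k1 u0 g1 !scaler0.
- by rewrite !uD hx hy scalerDr.
- by rewrite gM uD !kM gM kk kki hx hy scalerDr -scalerAl -scalerAr.
Qed.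

Lemma uact_KE f : uact_gen gK (uact_gen gE f) = q%:C *: uact_gen gE (uact_gen gK f).
Proof.
apply: uact_comm => // -[]; rewrite ?ugE /= ?uZ ?ugE /= ?u0 ?scaler0 //;
by rewrite !scalerA ?invrK ?qE ?qiE; congr (_ *: _); field.
Qed.

Lemma uact_KiE f : uact_gen gKi (uact_gen gE f) = q^-1%:C *: uact_gen gE (uact_gen gKi f).
Proof.
apply: uact_comm => // -[]; rewrite ?ugE /= ?uZ ?ugE /= ?u0 ?scaler0 //;
by rewrite !scalerA ?invrK ?qE ?qiE; congr (_ *: _); field.
Qed.

Lemma uact_KF f : uact_gen gK (uact_gen gF f) = q^-1%:C *: uact_gen gF (uact_gen gK f).
Proof.
apply: uact_comm => // -[]; rewrite ?ugE /= ?uZ ?ugE /= ?u0 ?scaler0 //;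
by rewrite !scalerA ?invrK ?qE ?qiE; congr (_ *: _); field.
Qed.

Lemma uact_KiF f : uact_gen gKi (uact_gen gF f) = q%:C *: uact_gen gF (uact_gen gKi f).
Proof.
apply: uact_comm => // -[]; rewrite ?ugE /= ?uZ ?ugE /= ?u0 ?scaler0 //;
by rewrite !scalerA ?invrK ?qE ?qiE; congr (_ *: _); field.
Qed.

Lemma uact_EF f :
  uact_gen gE (uact_gen gF f) - uact_gen gF (uact_gen gE f) =
  ((q - q^-1)^-1)%:C *:
    (uact_gen gK (uact_gen gK f) - uact_gen gKi (uact_gen gKi f)).
Proof.
rewrite qqE.
elim/s3q_ind: f => [||||z|x y hx hy|x y hx hy].
- rewrite !(ugE, uZ, u0) /= ?(ugE, uZ, u0) /= !scalerA ?sub0r ?subr0 -scalerBl scalerA -?scaleNr.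
  rewrite ?invrK ?qE ?qiE; congr (_ *: _).
  by field; apply/andP; split; [exact: p_neq0 | exact: pden4].
- rewrite !(ugE, uZ, u0) /= ?(ugE, uZ, u0) /= !scalerA ?sub0r ?subr0 -scalerBl scalerA -?scaleNr.
  rewrite -[LHS]scale1r.
  rewrite ?invrK ?qE ?qiE; congr (_ *: _).
  by field; apply/andP; split; [exact: p_neq0 | exact: pden4].
- rewrite !(ugE, uZ, u0) /= ?(ugE, uZ, u0) /= !scalerA ?sub0r ?subr0 -scalerBl scalerA -?scaleNr.
  rewrite -scaleN1r.
  rewrite ?invrK ?qE ?qiE; congr (_ *: _).
  by field; apply/andP; split; [exact: p_neq0 | exact: pden4].
- rewrite !(ugE, uZ, u0) /= ?(ugE, uZ, u0) /= !scalerA ?sub0r ?subr0 -scalerBl scalerA -?scaleNr.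
  rewrite ?invrK ?qE ?qiE; congr (_ *: _).
  by field; apply/andP; split; [exact: p_neq0 | exact: pden4].
- by rewrite !(uZ, uact_gen1) /= !(u0, uZ, uact_gen1) /= !scaler0 !subrr scaler0.
- by rewrite !uD opprD addrACA hx hy -scalerDr opprD addrACA.
- have eK z : uact_gen gE (uact_gen gKi z) = q%:C *: uact_gen gKi (uact_gen gE z).
    by rewrite uact_KiE scalerA qE qiE [_ * _](_ : _ = 1) ?scale1r //; field.
  have fK z : uact_gen gK (uact_gen gF z) = q^-1%:C *: uact_gen gF (uact_gen gK z).
    exact: uact_KF.
  have qqi : q%:C * q^-1%:C = 1 by rewrite qE qiE; field.
  rewrite !(uact_genM, uD) uact_KE uact_KiF eK fK.
  rewrite -!scalerAl -!scalerAr !scalerA qqi scale1r.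
  have zE (V : zmodType) (A1 A2 X Y B1 B2 : V) :
      A1 + X + (Y + B1) - (A2 + Y + (X + B2)) = (A1 - A2) + (B1 - B2).
    rewrite (addrC Y) (addrC X B2) !(addrACA _ _ B1) !(addrACA _ _ B2).
    by rewrite (addrC Y X) [- (_ + (X + Y))]opprD (addrACA (A1 + B1)) subrr addr0 opprD.
  rewrite zE -mulrBl -mulrBr hx hy -scalerAl -scalerAr -scalerDr.
  by rewrite mulrBl mulrBr addrA subrK.
Qed.

Lemma uact_rel s t : uq_rel s t -> forall f, uact_expr s f = uact_expr t f.
Proof.
case=> f /=; rewrite ?scale1r.
- exact: uact_KKi.
- exact: uact_KiK.
- exact: uact_KE.
- exact: uact_KiE.
- exact: uact_KF.
- exact: uact_KiF.
- by rewrite !scaleN1r uact_EF.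
Qed.

Definition uact (h : Uq) : S -> S := uact_expr (repr h).

Lemma uact_cong s t : cong uq_rel s t -> forall f, uact_expr s f = uact_expr t f.
Proof.
elim=> //= {s t}.
- by move=> s t /uact_rel.
- by move=> s t u _ e1 _ e2 f; rewrite e1 e2.
- by move=> s s' t t' _ e1 _ e2 f; rewrite e1 e2.
- by move=> s s' t t' _ e1 _ e2 f; rewrite e2 e1.
- by move=> *; rewrite addrA.
- by move=> *; rewrite addrC.
- by move=> *; rewrite scale0r add0r.
- by move=> *; rewrite scaleN1r addNr scale0r.
- by move=> *; rewrite scale1r.
- move=> s t u f; have := uact_expr_linear s 1 (uact_expr t f) (uact_expr u f).
  by rewrite !scale1r.
- by move=> *; rewrite scalerDl.
- by move=> *; rewrite scalerA.
- move=> z s f; have us := uact_expr_linear s.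
  have l0 : uact_expr s 0 = 0.
    by have := us (-1) 0 0; rewrite scaler0 addr0 scaleN1r addNr.
  by have := us z f 0; rewrite !addr0 l0 addr0.
Qed.

Lemma uactE s f : uact (uq_cls s) f = uact_expr s f.
Proof. exact/uact_cong/cong_repr. Qed.

Lemma uactM h k f : uact (h * k) f = uact h (uact k f).
Proof.
have [s ->] := uq_cls_surj h; have [t ->] := uq_cls_surj k.
by rewrite -uq_clsM !uactE.
Qed.

Lemma uact_algM t f g :
  uact (uq_cls t) (f * g) = \sum_(x <- uq_coprod t) uact x.1 f * uact x.2 g.
Proof.
elim: t f g => [x|z|s IHs t IHt|s IHs t IHt] f g.
- rewrite uactE /= uact_genM.
  by case: x => /=; rewrite !big_cons big_nil !uactE ?addr0.
- rewrite uactE /= big_seq1 -uq_clsS -[1]scale1r -uq_clsS !uactE /=.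
  by rewrite scale1r scalerAl.
- by rewrite uq_clsD /= big_cat /= -IHs -IHt -uq_clsD !uactE.
- rewrite uq_clsM uactM IHt big_allpairs_dep /=.
  have uS : uact (uq_cls s) = uact_expr s by apply: funext => x; rewrite uactE.
  rewrite [RHS]exchange_big /=.
  have us := uact_expr_linear s.
  have u0' : uact_expr s 0 = 0.
    by have := us (-1) 0 0; rewrite scaler0 addr0 scaleN1r addNr.
  have uD' x y : uact_expr s (x + y) = uact_expr s x + uact_expr s y.
    by have := us 1 x y; rewrite !scale1r.
  rewrite uS (big_morph _ uD' u0') -uS.
  apply: eq_bigr => y _; rewrite IHs.
  by apply: eq_bigr => x _; rewrite !uactM.
Qed.

Lemma uact_counit h : uact h 1 = (uq_counit h)%:A.
Proof.
have [s ->] := uq_cls_surj h.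
rewrite uactE /uq_counit (pevalE uq_counit_rel).
elim: s => [[]|z|s IHs t IHt|s IHs t IHt] /=; rewrite ?uact_gen1 ?scale0r ?scale1r //.
- by rewrite [z *: (1 : C^o)]mulr1.
- by rewrite IHs IHt scalerDl.
- rewrite IHt; have us := uact_expr_linear s.
  have u0' : uact_expr s 0 = 0.
    by have := us (-1) 0 0; rewrite scaler0 addr0 scaleN1r addNr.
  by have := us (teval uq_counit_gen t) 1 0; rewrite !addr0 u0' addr0 => ->;
    rewrite IHs scalerA mulrC.
Qed.

Lemma uact_is_action : is_uq_action uact.
Proof.
split.
- move=> f z h k; have [s ->] := uq_cls_surj h; have [t ->] := uq_cls_surj k.
  by rewrite -uq_clsZ -uq_clsD !uactE.
- by move=> h z f g; have [s ->] := uq_cls_surj h; rewrite !uactE; apply: uact_expr_linear.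
- by move=> f; rewrite -[1]scale1r -uq_clsS uactE /= scale1r.
- exact: uactM.
- exact: uact_algM.
- exact: uact_counit.
- by rewrite !uactE /= !ugE /= rqiE.
- by rewrite !uactE /= !ugE /= rqiE invrK.
- by rewrite !uactE /= !ugE.
- by rewrite !uactE /= !ugE.
Qed.

End Existence.

Lemma uq_action_exists : 0 < q -> q != 1 -> exists act, is_uq_action act.
Proof. by move=> q0 q1; exists (uact); apply: uact_is_action. Qed.

Variant direction := dplus | dminus | dz.

Definition Xop (d : direction) : Uq :=
  match d with
  | dplus => rq *: (uqE * uqK)
  | dminus => rqi *: (uqF * uqK)
  | dz => (1 - q ^- 2)^-1%:C *: (1 - uqK ^+ 4)
  end.

Definition sigmaop (d : direction) : Uq :=
  match d with
  | dplus | dminus => uqK ^+ 2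
  | dz => uqK ^+ 4
  end.

Definition in_tangent (X : Uq) : bool :=
  `[< exists x y z : C, X = x *: Xop dplus + y *: Xop dminus + z *: Xop dz >].

Fact in_tangent_closed : submod_closed in_tangent.
Proof.
split.
  by apply/asboolP; exists 0, 0, 0; rewrite !scale0r !addr0.
move=> k u v /asboolP[x [y [z ->]]] /asboolP[x' [y' [z' ->]]].
apply/asboolP; exists (k * x + x'), (k * y + y'), (k * z + z').
move: (Xop dplus) (Xop dminus) (Xop dz) => Xp Xm Xz.
by rewrite !scalerDr !scalerA !scalerDl addrACA [X in X + _ = _]addrACA.
Qed.
HB.instance Definition _ := GRing.isSubmodClosed.Build C Uq in_tangent
  in_tangent_closed.

Definition TS3q := {X : Uq | in_tangent X}.
HB.instance Definition _ := SubType.on TS3q.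
HB.instance Definition _ := Choice.on TS3q.
HB.instance Definition _ := [SubChoice_isSubLmodule of TS3q by <:].

Fact Xop_tangent d : in_tangent (Xop d).
Proof.
apply/asboolP; case: d.
- by exists 1, 0, 0; rewrite !scale0r scale1r !addr0.
- by exists 0, 1, 0; rewrite !scale0r scale1r add0r addr0.
- by exists 0, 0, 1; rewrite !scale0r scale1r !add0r.
Qed.

Definition Xtan (d : direction) : TS3q := Sub (Xop d) (Xop_tangent d).

(* Right [S]-modules are left modules over the converse ring [S^c]. *)
Variable M : lmodType S^c.

Definition ract (m : M) (f : S) : M := (f : S^c) *: m.

Definition cscale (z : C) (m : M) : M := ract m z%:A.

Record is_right_q_affine_connection (act : Uq -> S -> S)
    (nabla : TS3q -> M -> M) : Prop := IsRightQAffineConnection {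
  nabla_linearl : forall z X Y m,
    nabla (z *: X + Y) m = cscale z (nabla X m) + nabla Y m;
  nabla_linearr : forall z X m n,
    nabla X (cscale z m + n) = cscale z (nabla X m) + nabla X n;
  nabla_leibniz : forall d m f,
    nabla (Xtan d) (ract m f) =
    ract (nabla (Xtan d) m) (act (sigmaop d) f) + ract m (act (Xop d) f)
}.

End Uq.

Definition projective (A : pzRingType) (P : lmodType A) : Prop :=
  forall (M N : lmodType A) (g : {linear M -> N}) (f : {linear P -> N}),
    (forall n, exists m, g m = n) ->
    exists h : {linear P -> M}, forall p, g (h p) = f p.

(* Main.v *)
From HB Require Import structures.
Require Import Defs.
From mathcomp Require Import all_boot all_order all_algebra.
From mathcomp Require Import boolp reals complex ring.

(* For each of the three directions, M x M becomes a module extension of M by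
   the twisted action (m, n) f = (m f, n sigma(f) + m X(f)); the module axioms
   are exactly the twisted Leibniz rule for X.  Lifting the identity of the
   projective module M along the first projection gives a section
   m |-> (m, D m), and linearity of the section is the Leibniz rule for D.
   To extend linearly to the span of X_+, X_-, X_z one needs these to be
   linearly independent, which is read off the two-dimensional representation
   of U_q(su(2)). *)

Import Order.TTheory GRing.Theory Num.Theory.
Local Open Scope ring_scope.
Local Open Scope complex_scope.

(** * Skew derivations of a ring and twisted connections on projective modules *)

Section SkewConnection.
Set Implicit Arguments.
Unset Strict Implicit.
Unset Printing Implicit Defensive.
Variables (A : pzRingType) (sigma delta : A -> A).

(** The Leibniz rule is that of [X_a] with all products reversed, since right modules are encoded as
    left modules over the converse ring. *)
Record skew_derivation : Prop := SkewDerivation {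
  skew_sigmaD : {morph sigma : a b / a + b};
  skew_sigmaM : {morph sigma : a b / a * b};
  skew_sigma1 : sigma 1 = 1;
  skew_deltaD : {morph delta : a b / a + b};
  skew_deltaM : forall a b, delta (a * b) = sigma a * delta b + delta a * b
}.

Hypothesis sd : skew_derivation.
Variable M : lmodType A.

Lemma skew_delta1 : delta 1 = 0.
Proof.
have := skew_deltaM sd 1 1; rewrite mulr1 (skew_sigma1 sd) mul1r mulr1.
by move/eqP; rewrite -subr_eq subrr eq_sym => /eqP.
Qed.

(* The module axioms need the proof [sd], so the alias carries it. *)
Definition skew_ext of skew_derivation := (M * M)%type.
Local Notation N := (skew_ext sd).
HB.instance Definition _ := GRing.Zmodule.on N.

(** Here [a] acts through the lower triangular matrix with rows ([a], 0) and ([delta a], [sigma a]);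
    this assignment is a ring morphism. *)
Definition skew_scale (a : A) (u : N) : N :=
  (a *: u.1, sigma a *: u.2 + delta a *: u.1).

Lemma skew_scaleA a b u : skew_scale a (skew_scale b u) = skew_scale (a * b) u.
Proof.
rewrite /skew_scale /= skew_sigmaM // skew_deltaM // scalerDr scalerDl !scalerA.
by rewrite addrA.
Qed.

Lemma skew_scale1 : left_id 1 skew_scale.
Proof.
by case=> m n; rewrite /skew_scale skew_sigma1 // skew_delta1 !scale1r scale0r addr0.
Qed.

Lemma skew_scaleDr : right_distributive skew_scale +%R.
Proof. by move=> a u v; congr pair; rewrite /= !scalerDr // addrACA. Qed.

Lemma skew_scaleDl u : {morph skew_scale^~ u : a b / a + b}.
Proof.
move=> a b; congr pair; rewrite /= ?scalerDl //.
by rewrite skew_sigmaD // skew_deltaD // !scalerDl addrACA.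
Qed.

HB.instance Definition _ := GRing.Zmodule_isLmodule.Build A N
  skew_scaleA skew_scale1 skew_scaleDr skew_scaleDl.

Definition skew_proj (u : N) : M := u.1.

Fact skew_proj_linear : linear skew_proj.
Proof. by []. Qed.
HB.instance Definition _ :=
  GRing.isLinear.Build A N M *:%R skew_proj skew_proj_linear.

Lemma projective_skew_connection : projective M ->
  exists D : M -> M, {morph D : m n / m + n} /\
    forall a m, D (a *: m) = sigma a *: D m + delta a *: m.
Proof.
move=> projM.
have surj (m : M) : exists u, skew_proj u = m by exists (m, 0).
have [h hK] := projM _ _ skew_proj idfun surj.
exists (fun m => (h m).2); split=> [m n|a m].
  by rewrite linearD.
(* The second component of the twisted action involves [(h m).1], which is [m] because [h] is a
   section. *)
by rewrite linearZ; congr (_ + _ *: _); exact: (hK m).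
Qed.
End SkewConnection.

(** * The tangent vectors act on the quantum sphere as skew derivations *)

Section Action.
Set Implicit Arguments.
Unset Strict Implicit.
Unset Printing Implicit Defensive.
Variables (R : realType) (q : R) (act : Uq q -> S3q q -> S3q q).
Hypothesis act_action : is_uq_action act.
Local Notation C := R[i].

Lemma actDr h f g : act h (f + g) = act h f + act h g.
Proof. by have := uq_act_linearr act_action h 1 f g; rewrite !scale1r. Qed.

Lemma act0r h : act h 0 = 0.
Proof. by apply: (addIr (act h 0)); rewrite -actDr !add0r. Qed.

Lemma actDl h k f : act (h + k) f = act h f + act k f.
Proof. by have := uq_act_linearl act_action f 1 h k; rewrite !scale1r. Qed.

Lemma act0l f : act 0 f = 0.
Proof. by apply: (addIr (act 0 f)); rewrite -actDl !add0r. Qed.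

Lemma actZl z h f : act (z *: h) f = z *: act h f.
Proof. by have := uq_act_linearl act_action f z h 0; rewrite act0l !addr0. Qed.

Lemma actNl h f : act (- h) f = - act h f.
Proof. by rewrite -scaleN1r actZl scaleN1r. Qed.

Lemma actZr h z f : act h (z *: f) = z *: act h f.
Proof. by have := uq_act_linearr act_action h z f 0; rewrite act0r !addr0. Qed.

(** [K] is group-like, so its powers act multiplicatively. *)
Lemma act_KM n f g : act (uqK q ^+ n) (f * g) =
  act (uqK q ^+ n) f * act (uqK q ^+ n) g.
Proof.
elim: n f g => [|n IHn] f g; first by rewrite !expr0 !(uq_act1 act_action).
rewrite exprSr !(uq_actM act_action) -IHn; congr (act _ _).
by rewrite (uq_act_algM act_action) /= big_seq1.
Qed.

Lemma act_KiK f : act (uqKi q) (act (uqK q) f) = f.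
Proof.
rewrite -(uq_actM act_action) -uq_clsM (uq_cls_rel (@uq_KiK _ q)) uq_clsS scale1r.
exact: (uq_act1 act_action).
Qed.

Lemma act_sigmaM d f g : act (sigmaop q d) (f * g) =
  act (sigmaop q d) f * act (sigmaop q d) g.
Proof. by case: d; apply: act_KM. Qed.

Lemma act_K1 n : act (uqK q ^+ n) 1 = 1.
Proof.
have K1 : act (uqK q) 1 = 1.
  by rewrite (uq_act_alg1 act_action) /uq_counit (pevalE (@uq_counit_rel _ q)) scale1r.
elim: n => [|n IHn]; first by rewrite expr0 (uq_act1 act_action).
by rewrite exprSr (uq_actM act_action) K1.
Qed.

Lemma act_sigma1 d : act (sigmaop q d) 1 = 1.
Proof. by case: d; apply: act_K1. Qed.

Lemma act_XM d f g : act (Xop q d) (f * g) =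
  f * act (Xop q d) g + act (Xop q d) f * act (sigmaop q d) g.
Proof.
case: d; rewrite /= !actZl.
(* The trailing [K] of [X_+] and [X_-] acts first: it cancels the [K^-1] in the coproduct of [E] or
   [F] and turns the [K] there into [K^2]. *)
1,2: rewrite !(uq_actM act_action) -[uqK q]expr1 act_KM !expr1;
  rewrite (uq_act_algM act_action) /= !big_cons big_nil /= addr0;
  by rewrite act_KiK scalerDr -scalerAl -scalerAr addrC.
(* The difference of f g and K^4(f) K^4(g) telescopes through f K^4(g). *)
rewrite !actDl !actNl !(uq_act1 act_action) act_KM.
rewrite -scalerAl -scalerAr -scalerDr mulrBr mulrBl.
by rewrite addrA subrK.
Qed.

Lemma act_skew_derivation d :
  @skew_derivation (S3q q)^c (act (sigmaop q d)) (act (Xop q d)).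
Proof.
split=> [f g|f g||f g|f g].
- exact: actDr.
- exact: act_sigmaM.
- exact: act_sigma1.
- exact: actDr.
- by rewrite [LHS]act_XM addrC.
Qed.

Lemma act_sigma_alg d z : act (sigmaop q d) z%:A = z%:A.
Proof. by rewrite actZr act_sigma1. Qed.

Lemma act_X_alg d z : act (Xop q d) z%:A = 0.
Proof. by rewrite actZr (skew_delta1 (act_skew_derivation d)) scaler0. Qed.

End Action.

(** * Arithmetic of explicit two-by-two matrices *)

Section Mx2.
Set Implicit Arguments.
Unset Strict Implicit.
Unset Printing Implicit Defensive.
Variable A : comNzRingType.
Implicit Types a b c d : A.

Definition mx2 a b c d : 'M[A]_2 :=
  \matrix_(i, j) (if i == 0 then if j == 0 then a else b
                  else if j == 0 then c else d).

Let mx2P (X Y : 'M[A]_2) :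
  X 0 0 = Y 0 0 -> X 0 1 = Y 0 1 -> X 1 0 = Y 1 0 -> X 1 1 = Y 1 1 -> X = Y.
Proof.
move=> h00 h01 h10 h11; apply/matrixP => i j.
have E (k : 'I_2) : k = 0 \/ k = 1.
  by case: k => -[|[|//]] hk; [left | right]; apply/val_inj.
by case: (E i) => ->; case: (E j) => ->.
Qed.

Lemma mx2D a b c d a' b' c' d' :
  mx2 a b c d + mx2 a' b' c' d' = mx2 (a + a') (b + b') (c + c') (d + d').
Proof. by apply: mx2P; rewrite !mxE. Qed.

Lemma mx2Z z a b c d : z *: mx2 a b c d = mx2 (z * a) (z * b) (z * c) (z * d).
Proof. by apply: mx2P; rewrite !mxE. Qed.

Lemma mx2_1 : 1 = mx2 1 0 0 1.
Proof. by apply: mx2P; rewrite !mxE. Qed.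

Lemma mx2M a b c d a' b' c' d' : mx2 a b c d * mx2 a' b' c' d' =
  mx2 (a * a' + b * c') (a * b' + b * d') (c * a' + d * c') (c * b' + d * d').
Proof. by apply: mx2P; rewrite !mxE big_ord_recl big_ord1 !mxE. Qed.
End Mx2.

(** * Coordinates on the tangent space from the fundamental representation *)

Section TangentCoordinates.
Set Implicit Arguments.
Unset Strict Implicit.
Unset Printing Implicit Defensive.
Variables (R : realType) (q : R).
Hypotheses (q_gt0 : 0 < q) (q_neq1 : q != 1).
Local Notation C := R[i].
Local Notation p := ((Num.sqrt q)%:C).

Definition fund_rep (g : uq_gen) : 'M[C]_2 :=
  match g with
  | gE => mx2 0 1 0 0
  | gF => mx2 0 0 1 0
  | gK => mx2 p 0 0 p^-1
  | gKi => mx2 p^-1 0 0 p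
  end.

Let p_neq0 : p != 0.
Proof. by rewrite fmorph_eq0 sqrtr_eq0 -ltNge. Qed.
Let qE : q%:C = p * p.
Proof. by rewrite -rmorphM -expr2 sqr_sqrtr // ltW. Qed.
Let rqiE : (Num.sqrt q)^-1%:C = p^-1.
Proof. by rewrite fmorphV. Qed.
Let qiE : q^-1%:C = p^-1 * p^-1.
Proof. by rewrite fmorphV /= qE invfM. Qed.
Let qqE : ((q - q^-1)^-1)%:C = (p * p - p^-1 * p^-1)^-1.
Proof. by rewrite fmorphV rmorphB /= qE qiE. Qed.
(** This is q^2 - 1, which governs the denominators q - q^-1 and 1 - q^-2; for q > 0 it vanishes
    only at q = 1. *)
Let pden : p * p * (p * p) - 1 != 0.
Proof.
rewrite -qE -rmorphM -(rmorph1 (real_complex R)) -rmorphB fmorph_eq0 subr_eq0.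
by rewrite -expr2 -[1](expr1n _ 2) eqrXn2 ?ltW.
Qed.

(** [E] and [F] exchange eigenlines of [K] whose eigenvalues have ratio q, and both sides of the
    relation for [E, F] become diag(1, -1). *)
Lemma fund_rep_rel s t : uq_rel q s t -> teval fund_rep s = teval fund_rep t.
Proof.
case; rewrite /= ?mx2_1 !(mx2M, mx2Z, mx2D) ?qqE ?qiE ?qE;
  move: p p_neq0 pden => r r0 r1; congr mx2;
  rewrite ?(mul0r, mulr0, addr0, add0r, mulr1, mul1r) //;
  by field; rewrite ?r0 ?r1.
Qed.

Definition fund_mx : Uq q -> 'M[C]_2 := @peval _ _ (uq_rel q) 'M[C]_2 fund_rep.

Let fM X Y : fund_mx (X * Y) = fund_mx X * fund_mx Y.
Proof. exact: (pevalM fund_rep_rel). Qed.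
Let fD X Y : fund_mx (X + Y) = fund_mx X + fund_mx Y.
Proof. exact: (pevalD fund_rep_rel). Qed.
Let fZ z X : fund_mx (z *: X) = z *: fund_mx X.
Proof. exact: (pevalZ fund_rep_rel). Qed.
Let f1 : fund_mx 1 = 1. Proof. exact: (peval1 fund_rep_rel). Qed.
Let fE : fund_mx (uqE q) = mx2 0 1 0 0.
Proof. exact: (pevalG fund_rep_rel). Qed.
Let fF : fund_mx (uqF q) = mx2 0 0 1 0.
Proof. exact: (pevalG fund_rep_rel). Qed.
Let fK : fund_mx (uqK q) = mx2 p 0 0 p^-1.
Proof. exact: (pevalG fund_rep_rel). Qed.

Lemma fund_Xplus : fund_mx (Xop q dplus) = mx2 0 1 0 0.
Proof.
rewrite [LHS]fZ [X in _ *: X]fM fE fK mx2M mx2Z.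
by rewrite ?(mul0r, mulr0, addr0, add0r, mul1r) divff.
Qed.

Lemma fund_Xminus : fund_mx (Xop q dminus) = mx2 0 0 1 0.
Proof.
rewrite [LHS]fZ [X in _ *: X]fM fF fK mx2M mx2Z rqiE.
by rewrite ?(mul0r, mulr0, addr0, add0r, mul1r) mulVf.
Qed.

(** [K^4] becomes diag(q^2, q^-2), so dividing by 1 - q^-2 normalises the last entry to 1. *)
Lemma fund_Xz : fund_mx (Xop q dz) = mx2 (- p ^+ 4) 0 0 1.
Proof.
have q2E : (1 - q ^- 2)^-1%:C = (1 - p^-1 * p^-1 * (p^-1 * p^-1))^-1.
  by rewrite fmorphV rmorphB rmorph1 /= -exprVn expr2 rmorphM /= qiE.
have fK4 : fund_mx (uqK q ^+ 4) =
    mx2 (p * (p * (p * p))) 0 0 (p^-1 * (p^-1 * (p^-1 * p^-1))).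
  rewrite (exprS _ 3) (exprS _ 2) (exprS _ 1) expr1 fM [X in _ * X]fM.
  rewrite [X in _ * (_ * X)]fM fK !mx2M.
  by rewrite !(mul0r, mulr0, addr0, add0r).
rewrite [LHS]fZ [X in _ *: X]fD f1 -scaleN1r (fZ (-1) (uqK q ^+ 4)) fK4.
rewrite mx2_1 mx2Z mx2D mx2Z q2E.
move: p p_neq0 pden => r r0 r1; congr mx2;
  rewrite ?(mul0r, mulr0, addr0, add0r, mulr1, mul1r) //; field; rewrite ?r0 ?r1 //.
Qed.

(* The entries of [fund_mx] in the positions [01], [10] and [11] are the
   coordinates dual to [X_+], [X_-] and [X_z]. *)
Definition tan_coord (d : direction) (X : Uq q) : C :=
  match d with
  | dplus => fund_mx X 0 1
  | dminus => fund_mx X 1 0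
  | dz => fund_mx X 1 1
  end.

Lemma tan_coordP d z X Y :
  tan_coord d (z *: X + Y) = z * tan_coord d X + tan_coord d Y.
Proof. by case: d; rewrite /= fD fZ !mxE. Qed.

(** Duality makes the three vectors independent, so values prescribed on them extend linearly
    without conflict. *)
Lemma tan_coord_Xop (d e : direction) :
  tan_coord d (Xop q e) = match d, e with
    | dplus, dplus | dminus, dminus | dz, dz => 1
    | _, _ => 0
    end.
Proof.
by case: e; rewrite /tan_coord ?fund_Xplus ?fund_Xminus ?fund_Xz; case: d; rewrite mxE.
Qed.
End TangentCoordinates.

(** * Complex scalars on a right module *)

Section RightModule.
Set Implicit Arguments.
Unset Strict Implicit.
Unset Printing Implicit Defensive.
Variables (R : realType) (q : R) (M : lmodType (S3q q)^c).
Implicit Types (m n : M) (z w : R[i]).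

Lemma cscaleDr z m n : cscale z (m + n) = cscale z m + cscale z n.
Proof. exact: scalerDr. Qed.

Lemma cscaleA z w m : cscale z (cscale w m) = cscale (z * w) m.
Proof.
rewrite /cscale /ract scalerA; congr (_ *: _).
(* The product is taken in the converse ring, but complex scalars commute. *)
by rewrite [LHS]mulr_algr scalerA mulrC.
Qed.

Lemma cscale1 m : cscale 1 m = m.
Proof. by rewrite /cscale /ract scale1r; exact: scale1r. Qed.

Lemma cscale0 m : cscale 0 m = 0.
Proof. by rewrite /cscale /ract scale0r; exact: scale0r. Qed.

Lemma cscaleDl z w m : cscale (z + w) m = cscale z m + cscale w m.
Proof. by rewrite /cscale /ract scalerDl; exact: scalerDl. Qed.
End RightModule.

(** * Assembling the connection from the three directions *)

Theorem mainTheorem3 (R : realType) (q : R) (q_gt0 : 0 < q) (q_neq1 : q != 1)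
    (act : Uq q -> S3q q -> S3q q) (act_action : is_uq_action act)
    (M : lmodType (S3q q)^c) (projM : projective M) :
  exists nabla : TS3q q -> M -> M, is_right_q_affine_connection act nabla.
Proof.
have connD d : exists D : M -> M, {morph D : m n / m + n} /\
    forall f m, D (ract m f) =
      ract (D m) (act (sigmaop q d) f) + ract m (act (Xop q d) f).
  (* Scaling by [f] over the converse ring unfolds to [ract m f], so the two Leibniz rules agree by
     conversion. *)
  exact (projective_skew_connection (act_skew_derivation act_action d) projM).
have {connD} [D DP] := choice connD.
have DD d m n : D d (m + n) = D d m + D d n by case: (DP d).
have DX d f m : D d (ract m f) =
      ract (D d m) (act (sigmaop q d) f) + ract m (act (Xop q d) f).
  by case: (DP d).
(* [D d] is only known to be additive; homogeneity is its Leibniz rule at a scalar, which [sigmaop]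
   fixes and [Xop] kills. *)
have DZ d z m : D d (cscale z m) = cscale z (D d m).
  rewrite /cscale DX (act_sigma_alg act_action) (act_X_alg act_action).
  by rewrite [X in _ + X]scale0r addr0.
pose term d (X : TS3q q) m := cscale (tan_coord d (val X)) (D d m).
have termX d z X Y m : term d (z *: X + Y) m = cscale z (term d X m) + term d Y m.
  by rewrite /term tan_coordP // cscaleDl cscaleA.
have termM d z X m n : term d X (cscale z m + n) = cscale z (term d X m) + term d X n.
  by rewrite /term DD DZ cscaleDr !cscaleA mulrC.
exists (fun X m => term dplus X m + term dminus X m + term dz X m).
have big4 (z : R[i]) (a b c a' b' c' : M) :
    cscale z a + a' + (cscale z b + b') + (cscale z c + c') =
    cscale z (a + b + c) + (a' + b' + c').
  by rewrite !cscaleDr (addrACA (cscale z a)) [LHS]addrACA.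
split=> [z X Y m|z X m n|d m f].
- by rewrite !termX big4.
- by rewrite !termM big4.
(* At [Xtan d] the dual coordinates leave only the summand [D d]. *)
- suff nablaX n : term dplus (Xtan q d) n + term dminus (Xtan q d) n +
      term dz (Xtan q d) n = D d n by rewrite !nablaX DX.
  by rewrite /term !tan_coord_Xop //; case: d; rewrite cscale1 !cscale0 ?addr0 ?add0r.
Qed.
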